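(* Every second-countable $T_0$ space is an $\omega$-Rudin space.
   Context: For a $T_0$ space $X$, the specialization order is $x\le y$ iff $x\in\overline{\{y\}}$; a subset is saturated if it is an upper set in this order (equivalently, an intersection of open sets). $\mathsf{K}(X)$ is the set of all nonempty compact saturated subsets of $X$. A nonempty set $A\subseteq X$ is irreducible if whenever $A\subseteq F_1\cup F_2$ with $F_1,F_2$ closed, then $A\subseteq F_1$ or $A\subseteq F_2$. For a family $\mathcal K$ of subsets of $X$, let $M(\mathcal K)$ be the set of closed sets $A\subseteq X$ with $A\cap K\ne\emptyset$ for all $K\in\mathcal K$, and let $m(\mathcal K)$ be the set of minimal (under inclusion) members of $M(\mathcal K)$. A family $\mathcal K\subseteq\mathsf K(X)$ is filtered if it is nonempty and for all $K_1,K_2\in\mathcal K$ there is $K_3\in\mathcal K$ with $K_3\subseteq K_1\cap K_2$. A closed set $A$ is an $\omega$-Rudin set if there is a countable filtered family $\mathcal K\subseteq\mathsf K(X)$ with $A\in m(\mathcal K)$. A $T_0$ space $X$ is an $\omega$-Rudin space if every irreducible closed subset of $X$ is an $\omega$-Rudin set. *)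

(* Defs.v *)
From mathcomp Require Import all_boot.
From mathcomp Require Import boolp classical_sets functions cardinality topology.

Set Implicit Arguments.
Unset Strict Implicit.
Unset Printing Implicit Defensive.

Local Open Scope classical_set_scope.

Section OmegaRudin.
Variable X : topologicalType.
Implicit Types (x y : X) (A B F : set X) (K : set (set X)).

Definition specialization x y : Prop := closure [set y] x.

Definition saturated A : Prop :=
  forall x y, specialization x y -> A x -> A y.

Definition nonempty_compact_saturated : set (set X) :=
  [set A | [/\ A !=set0, compact A & saturated A]].

Definition irreducible A : Prop :=
  A !=set0 /\
  forall F1 F2, closed F1 -> closed F2 ->
    A `<=` F1 `|` F2 -> A `<=` F1 \/ A `<=` F2.

Definition closed_meeting K : set (set X) :=
  [set A | closed A /\ forall B, K B -> A `&` B !=set0].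

Definition minimal_closed_meeting K : set (set X) :=
  [set A | closed_meeting K A /\
           forall B, closed_meeting K B -> B `<=` A -> B = A].

Definition filtered_family K : Prop :=
  K !=set0 /\
  forall A1 A2, K A1 -> K A2 -> exists2 A3, K A3 & A3 `<=` A1 `&` A2.

(* [countable] includes finite families. *)
Definition omega_rudin_set A : Prop :=
  closed A /\
  exists K, [/\ countable K, K `<=` nonempty_compact_saturated,
                filtered_family K & minimal_closed_meeting K A].

End OmegaRudin.

Definition omega_rudin_space (X : topologicalType) : Prop :=
  kolmogorov_space X /\
  forall A : set X, closed A -> irreducible A -> omega_rudin_set A.

(* Main.v *)
Require Import Defs.
From mathcomp Require Import all_boot.
From mathcomp Require Import boolp classical_sets functions cardinality topology.

(** Let [A] be irreducible and closed.  The members of a countable base that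
    meet [A] have the finite intersection property inside [A], so some sequence
    in [A] converges to every point of [A].  The saturations of its tails form a
    decreasing sequence of compact saturated sets.  A closed set is a lower set,
    so it meets all of them only if it contains infinitely many terms of the
    sequence, and then it contains every limit of the sequence, hence all of
    [A]. *)

Set Implicit Arguments.
Unset Strict Implicit.
Unset Printing Implicit Defensive.

Local Open Scope classical_set_scope.

Section Saturation.
Variable X : topologicalType.
Implicit Types (x y : X) (A S U C : set X) (u : nat -> X).

Definition saturation S : set X :=
  [set y | exists2 x, S x & specialization x y].

Lemma specialization_refl x : specialization x x.
Proof. exact: subset_closure. Qed.

Lemma specialization_nbhs x y U : nbhs x U -> specialization x y -> U y.
Proof. by move=> xU /(_ _ xU) [_ [->]]. Qed.

Lemma specialization_closed x y C :
  closed C -> C y -> specialization x y -> C x.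
Proof.
move=> Ccl Cy xy; apply: Ccl; apply: closureS xy.
by move=> _ ->.
Qed.

Lemma saturated_saturation S : saturated (saturation S).
Proof.
move=> y z yz [x Sx xy]; exists x => //.
exact: specialization_closed (@closed_closure _ _) yz xy.
Qed.

Lemma saturation_open S U : open U -> S `<=` U -> saturation S `<=` U.
Proof.
move=> Uo SU y [x /SU Ux]; apply: specialization_nbhs.
exact: open_nbhs_nbhs.
Qed.

(** A point of [C] that lies above some [x] in [S] pulls [x] into [C], since closed sets are lower
    sets. *)
Lemma closed_meets_saturation C S :
  closed C -> C `&` saturation S !=set0 -> C `&` S !=set0.
Proof.
move=> Ccl [y [Cy [x Sx xy]]]; exists x; split=> //.
exact: specialization_closed xy.
Qed.

Definition tail u n : set X := u @` [set m | n <= m].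

Lemma tailS u n m : n <= m -> tail u m `<=` tail u n.
Proof.
by move=> nm _ [k /= mk <-]; exists k => //=; apply: leq_trans mk.
Qed.

Lemma saturation_tailS u n m :
  n <= m -> saturation (tail u m) `<=` saturation (tail u n).
Proof. by move=> nm y [x /(tailS nm) ux xy]; exists x. Qed.

Lemma saturation_tail_succ u n :
  saturation (tail u n) `<=`
  specialization (u n) `|` saturation (tail u n.+1).
Proof.
move=> y [_ [m /= nm <-] my].
move: nm; rewrite leq_eqVlt => /predU1P[->|nm]; first by left.
by right; exists (u m) => //; exists m.
Qed.

(* An ultrafilter on the saturated tail either contains the principal upper set
   of some term, and converges to that term, or contains every later saturated
   tail, and converges to every limit of the sequence. *)
Lemma compact_saturation_tail u n :
  u @ \oo --> u n -> compact (saturation (tail u n)).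
Proof.
move=> u_un; rewrite compact_ultra => F UF Fn.
have tail_in m : n <= m -> saturation (tail u n) (u m).
  by move=> nm; exists (u m); [exists m | exact: specialization_refl].
have [[m nm Fm]|noF] :=
    pselect (exists2 m, n <= m & F (specialization (u m))).
  exists (u m); split=> [|U mU]; first exact: tail_in.
  by apply: filterS Fm => y; apply: specialization_nbhs.
exists (u n); split=> [|U]; first exact: tail_in.
rewrite nbhsE => -[V [Vo Vn] VU].
(* Passing to the next tail loses at most the principal upper set of one term, whose complement is
   in the ultrafilter [F]. *)
have Ftail k : F (saturation (tail u (n + k))).
  elim: k => [|k IHk]; first by rewrite addn0.
  have [Fk|Fk] := in_ultra_setVsetC (specialization (u (n + k))) UF.
    by case: noF; exists (n + k); rewrite ?leq_addr.
  rewrite addnS; apply: filterS (filterI IHk Fk) => y [yk nyk].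
  by have [|] := saturation_tail_succ yk.
(* The terms from [N] on lie in [V]; as open sets are upper sets, so does the saturation of the tail
   from [n + N]. *)
have [N _ NV] := u_un _ (open_nbhs_nbhs (conj Vo Vn)).
apply: filterS (Ftail N); apply: subset_trans VU.
apply: saturation_open => // _ [m /= nNm <-].
by apply: NV => /=; apply: leq_trans nNm; apply: leq_addl.
Qed.

End Saturation.

Section Irreducible.
Variable X : topologicalType.
Implicit Types (A U V : set X) (u : nat -> X).

(** Otherwise the complements of [U] and [V] would be closed sets covering [A], neither containing
    it. *)
Lemma irreducible_meetsI A U V : irreducible A -> open U -> open V ->
  A `&` U !=set0 -> A `&` V !=set0 -> A `&` (U `&` V) !=set0.
Proof.
move=> [_ Airr] Uo Vo [x [Ax Ux]] [y [Ay Vy]].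
apply: contrapT => AUV0.
have [|/(_ _ Ax)/(_ Ux)//|/(_ _ Ay)/(_ Vy)//] :=
  Airr (~` U) (~` V) (open_closedC Uo) (open_closedC Vo).
move=> z Az; rewrite -setCI => UVz.
by apply: AUV0; exists z.
Qed.

(** The [n]-th term is taken in [A] and in every base member that meets [A] and has code below [n].
    A basic neighbourhood of a point of [A] meets [A], hence contains all but finitely many
    terms. *)
Lemma irreducible_cvg_seq A : @second_countable X -> irreducible A ->
  exists2 u, (forall n, A (u n)) & forall a, A a -> u @ \oo --> a.
Proof.
move=> [B /countable_injP[f finj] [Bo Bbase]] Airr.
pose small n W := forall U, B U -> A `&` U !=set0 -> f U < n -> W `<=` U.
have small_open n : exists W, [/\ open W, A `&` W !=set0 & small n W].
  elim: n => [|n [W [Wo AW Wn]]].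
    exists setT; split=> //; first exact: openT.
    by rewrite setIT; case: Airr.
  (* By injectivity of [f], at most one base member has code [n]; [W] has to shrink only if that
     member exists and meets [A]. *)
  have [[U [BU AU fU]]|noU] :=
      pselect (exists U, [/\ B U, A `&` U !=set0 & f U = n]).
    exists (W `&` U); split.
    - by apply: openI => //; apply: Bo.
    - by apply: irreducible_meetsI => //; apply: Bo.
    move=> V BV AV; rewrite ltnS leq_eqVlt => /predU1P[fV|fV].
      by rewrite (finj V U) ?inE ?fV ?fU//; apply: subIsetr.
    by apply: subset_trans (Wn _ BV AV fV); apply: subIsetl.
  exists W; split=> // V BV AV; rewrite ltnS leq_eqVlt => /predU1P[fV|fV].
    by case: noU; exists V.
  exact: Wn.
have [u uP] : {u : nat -> X &
    forall n, A (u n) /\ exists2 W, small n W & W (u n)}.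
  apply: (@choice _ _ (fun n x => A x /\ exists2 W, small n W & W x)) => n.
  have [W [_ [x [Ax Wx]] Wn]] := small_open n.
  by exists x; split=> //; exists W.
exists u => [n|a Aa U]; first by have [] := uP n.
move=> /Bbase[V [BV Va] VU]; exists (f V).+1 => // n /= fVn.
have [_ [W Wn Wun]] := uP n.
by apply: VU; apply: (Wn V) => //; exists a.
Qed.

End Irreducible.

Theorem corollary6p8 (X : topologicalType) :
  @second_countable X -> kolmogorov_space X -> omega_rudin_space X.
Proof.
move=> X2 X0; split=> // A Acl Airr; split=> //.
have [u uA u_cvg] := irreducible_cvg_seq X2 Airr.
have tail_n n : saturation (tail u n) (u n).
  by exists (u n); [exists n => /= | exact: specialization_refl].
exists (range (fun n => saturation (tail u n))); split.
- exact: sub_countable (card_image_le _ _) (countableP _).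
- move=> _ [n _ <-]; split; first by exists (u n).
    exact/compact_saturation_tail/u_cvg.
  exact: saturated_saturation.
- split; first by exists (saturation (tail u 0)), 0.
  move=> _ _ [n _ <-] [m _ <-].
  exists (saturation (tail u (maxn n m))); first by exists (maxn n m).
  by rewrite subsetI; split; apply: saturation_tailS;
    rewrite ?leq_maxl ?leq_maxr.
split=> [|C [Ccl Cmeets] CA].
  by split=> // _ [n _ <-]; exists (u n).
(* If [a] is outside [C], the complement of [C] is a neighbourhood of [a] and contains a whole tail,
   yet [C] meets that tail. *)
apply/seteqP; split=> // a Aa; apply: contrapT => nCa.
have [N _ NC] := u_cvg a Aa _ (open_nbhs_nbhs (conj (closed_openC Ccl) nCa)).
have CN : C `&` saturation (tail u N) !=set0 by apply: Cmeets; exists N.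
have [y [Cy [n /= Nn yn]]] := closed_meets_saturation Ccl CN.
by apply: (NC n Nn); rewrite yn.
Qed.
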